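(* Let $k$ be an infinite field, $S=k[x_1,\ldots,x_n]$ with its standard grading, and let $\mathcal H(\mathcal X,\mathcal E,d)$ be a uniformly increasing hypergraph on the $n$ vertices $\mathcal X=\{x_1,\ldots,x_n\}$, with containment vector $a=(a_1,\ldots,a_n)$. Let $\mathcal I^{[*]}(\mathcal H)\subset S$ be the special dual of its inclusion ideal $\mathcal I(\mathcal H)$. Then $$\operatorname{reg}(\mathcal I^{[*]}(\mathcal H))\le \sum_{i=2}^{n} a_i .$$
   Context: Uniformly increasing hypergraph: a triple $\mathcal H(\mathcal X,\mathcal E,d)$ where $\mathcal X=\{x_1,\ldots,x_n\}$ is a finite set, $d$ is a positive integer, and $\mathcal E=\{E_1,\ldots,E_s\}$ is a (nonempty) collection of subsets of $\mathcal X$ with $E_i\subseteq E_j$ for $1\le i<j\le s$, $|E_i|\ge 2$ for all $i$, and $|E_{i+1}|=|E_i|+d$ for $1\le i<s$. Containment vector: $a=(a_1,\ldots,a_n)\in\mathbb N^n$ with $a_j=|\{i\in\{1,\ldots,s\} : x_j\in E_i\}|$. Vertices are identified with the variables of $S$. Inclusion ideal: $\mathcal I(\mathcal H)=(x^{b_1},\ldots,x^{b_s})\subset S$, where $x^{b_i}=\prod_{x\in E_i}x^{\,s-i+1}$, i.e. $b_i\in\mathbb N^n$ has $j$-th coordinate $s-i+1$ if $x_j\in E_i$ and $0$ otherwise. These monomials are the minimal generators. For $c,b\in\mathbb N^n$ with $b\preceq c$ coordinatewise, $c\setminus b\in\mathbb N^n$ is the vector whose $j$-th coordinate is $c_j+1-b_j$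 if $b_j\ge 1$ and $0$ if $b_j=0$. For $v\in\mathbb N^n$, $m^{v}=(x_j^{v_j} : v_j\ge 1)\subset S$. Special dual: the Alexander dual of $\mathcal I(\mathcal H)$ with respect to the containment vector $a$, i.e. $\mathcal I^{[*]}(\mathcal H)=\bigcap_{i=1}^{s} m^{a\setminus b_i}$ (one has $b_i\preceq a$ for all $i$). Castelnuovo–Mumford regularity: $\operatorname{reg}(I)=\max\{j-i : \beta_{ij}(I)\ne 0\}$, where $\beta_{ij}(I)$ are the graded Betti numbers of $I$ as an $S$-module. *)

(* Defs.v *)
From HB Require Import structures.
From mathcomp Require Import all_boot all_order all_algebra.
From mathcomp Require Import mpoly.

Set Implicit Arguments.
Unset Strict Implicit.
Unset Printing Implicit Defensive.

Import Order.TTheory GRing.Theory Num.Theory.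
Local Open Scope ring_scope.

Definition infinite_field (k : fieldType) : Prop :=
  forall s : seq k, exists x : k, x \notin s.

(** Vertices are the indices of the variables, and the edges
    E_1, ..., E_s are indexed from 0: the edge E_i is [edge (i - 1)]. *)
Record ui_hypergraph (n : nat) := UIHypergraph {
  step : nat;
  nedges : nat;
  edge : 'I_nedges -> {set 'I_n};
  step_gt0 : (0 < step)%N;
  nedges_gt0 : (0 < nedges)%N;
  edge_sub : forall i j : 'I_nedges, (i < j)%N -> edge i \subset edge j;
  edge_card_ge2 : forall i : 'I_nedges, (2 <= #|edge i|)%N;
  edge_card_step : forall i j : 'I_nedges,
    j = i.+1 :> nat -> #|edge j| = (#|edge i| + step)%N
}.

Definition containment_vector (n : nat) (H : ui_hypergraph n) : 'X_{1..n} :=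
  [multinom #|[set i : 'I_(nedges H) | j \in edge i]| | j < n].

(** Exponent vectors of the generators of the inclusion ideal; the exponent
    s - i + 1 becomes [nedges H - i] because edges are indexed from 0. *)
Definition inclusion_exponent (n : nat) (H : ui_hypergraph n)
    (i : 'I_(nedges H)) : 'X_{1..n} :=
  [multinom (if j \in edge i then nedges H - i else 0)%N | j < n].

Definition mnm_setminus (n : nat) (c b : 'X_{1..n}) : 'X_{1..n} :=
  [multinom (if (1 <= b j)%N then c j + 1 - b j else 0)%N | j < n].

Section Ideals.
Variables (k : fieldType) (n : nat).
Local Notation S := {mpoly k[n]}.

(** The ideal of S generated by a finite family. *)
Definition ideal_span (m : nat) (g : 'I_m -> S) : S -> Prop :=
  fun p => exists c : 'I_m -> S, p = \sum_(i < m) c i * g i.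

Definition inclusion_ideal (H : ui_hypergraph n) : S -> Prop :=
  ideal_span (fun i : 'I_(nedges H) => 'X_[inclusion_exponent i]).

(** m^v; the indices j with v_j = 0 contribute no generator. *)
Definition irreducible_ideal (v : 'X_{1..n}) : S -> Prop :=
  ideal_span (fun j : 'I_n => if (1 <= v j)%N then 'X_j ^+ v j else 0).

(** Alexander dual with respect to [a] of the monomial ideal whose minimal
    generators are the monomials with exponents [b i]. *)
Definition alexander_dual (a : 'X_{1..n}) (s : nat) (b : 'I_s -> 'X_{1..n}) :
    S -> Prop :=
  fun p => forall i : 'I_s, irreducible_ideal (mnm_setminus a (b i)) p.

Definition special_dual (H : ui_hypergraph n) : S -> Prop :=
  alexander_dual (containment_vector H) (@inclusion_exponent n H).

(** Homogeneous of integer degree; only 0 qualifies when [z < 0]. *)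
Definition zhomog (z : int) (p : S) : Prop :=
  forall m : 'X_{1..n}, m \in msupp p -> (mdeg m)%:Z = z.

(** Data of an augmented sequence of finite graded free modules
      ... -> F_2 -> F_1 -> F_0 -> S,
    where F_i is the direct sum of the S(- shift i e) for e < frank i.
    Elements of F_i are row vectors and the maps act by right
    multiplication. *)
Record free_sequence := FreeSequence {
  frank : nat -> nat;
  shift : forall i : nat, 'I_(frank i) -> int;
  aug : 'cV[S]_(frank 0);
  diff : forall i : nat, 'M[S]_(frank i.+1, frank i)
}.

(** [F] is a graded free resolution of the ideal [I]: all the maps preserve
    degrees and ... -> F_1 -> F_0 -> I -> 0 is exact. *)
Record graded_free_resolution (I : S -> Prop) (F : free_sequence) : Prop :=
  GradedFreeResolution {
  aug_homog : forall e : 'I_(frank F 0),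
    zhomog (shift e) (aug F e 0);
  diff_homog : forall (i : nat) (e : 'I_(frank F i.+1)) (f : 'I_(frank F i)),
    zhomog (shift e - shift f) (diff F i e f);
  aug_image : forall p : S,
    I p <-> exists v : 'rV[S]_(frank F 0), p = (v *m aug F) 0 0;
  exact_at0 : forall v : 'rV[S]_(frank F 0),
    v *m aug F = 0 <->
    exists w : 'rV[S]_(frank F 1), v = w *m diff F 0;
  exact_atS : forall (i : nat) (v : 'rV[S]_(frank F i.+1)),
    v *m diff F i = 0 <->
    exists w : 'rV[S]_(frank F i.+2), v = w *m diff F i.+1
}.

(** The complex of graded k-vector spaces obtained from
    ... -> F_1 -> F_0 -> 0 by tensoring over S with k = S/(x_1, ..., x_n):
    matrices are replaced by their constant terms. *)
Definition diff_k (F : free_sequence) (i : nat) :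
    'M[k]_(frank F i.+1, frank F i) :=
  map_mx (mcoeff 0%MM) (diff F i).

(** Its row space is the degree j component of F_i tensored with k. *)
Definition deg_part (F : free_sequence) (i : nat) (j : int) :
    'M[k]_(frank F i) :=
  diag_mx (\row_e (shift e == j)%:R).

Definition cycles (F : free_sequence) (i : nat) : 'M[k]_(frank F i) :=
  match i with
  | 0 => 1%:M
  | i'.+1 => kermx (diff_k F i')
  end.

(** dim_k H_i(F tensor k)_j, i.e. dim_k Tor_i(I, k)_j when [F] is a graded
    free resolution of [I]. *)
Definition tor_dim (F : free_sequence) (i : nat) (j : int) : nat :=
  (\rank (deg_part F i j :&: cycles F i)%MS
   - \rank (deg_part F i.+1 j *m diff_k F i))%N.

(** [beta] is the family of graded Betti numbers of [I]. Since Tor does not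
    depend on the resolution, at most one [beta] satisfies this. *)
Definition graded_betti (I : S -> Prop) (beta : nat -> int -> nat) : Prop :=
  exists F : free_sequence, graded_free_resolution I F /\
    forall (i : nat) (j : int), beta i j = tor_dim F i j.

(** reg(I) = r. *)
Definition regularity (I : S -> Prop) (r : int) : Prop :=
  exists beta : nat -> int -> nat, [/\ graded_betti I beta,
    exists i j, beta i j <> 0%N /\ j - i%:Z = r &
    forall i j, beta i j <> 0%N -> j - i%:Z <= r].

End Ideals.

(* Main.v *)
(** A monomial X^u lies in the special dual iff the intervals
    [s - a_j, s - a_j + u_j), j a vertex, cover [0, s). In a minimal cover at
    most one interval ends at s, so a minimal generator divides X^a and has the
    full exponent a_j > 0 in at most one variable. Hence the lcm of k generators
    misses X^a by at least N - k degrees, where N = |E_s| > s is the number of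
    variables with a_j > 0. The Taylor complex on the generators resolves the
    ideal, and its basis elements in homological degree i are lcms of i + 1
    generators, of degree at most |a| - N + i + 1 <= |a| - a_1 + i. Indexing the
    Taylor complex by tuples rather than subsets of generators makes it
    infinite, which is harmless for an upper bound on the shifts. *)

From Stdlib Require Import Classical.
Require Import Defs.
From mathcomp Require Import all_boot all_order all_algebra.
From mathcomp Require Import mpoly zify.
Import Order.TTheory GRing.Theory Num.Theory.
Local Open Scope ring_scope.

Set Implicit Arguments.
Unset Strict Implicit.
Unset Printing Implicit Defensive.

(** * Monomial ideals *)

Section MonomialOperations.
Variables (k : fieldType) (n : nat).
Local Notation S := {mpoly k[n]}.
Implicit Types (p q : S) (u b : 'X_{1..n}).

Lemma mcoeffMX_if p b u :
  (p * 'X_[b])@_u = if (b <= u)%MM then p@_(u - b) else 0.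
Proof.
case: ifPn => [le_bu | nle_bu].
  by rewrite -{1}(submK le_bu) addmC mcoeffMX.
apply/eqP; rewrite mcoeff_eq0 (perm_mem (msuppMX p b)).
by apply: contra nle_bu => /mapP[m _ ->]; apply: lem_addr.
Qed.

Definition mfilter (P : pred 'X_{1..n}) p : S :=
  \sum_(u <- msupp p | P u) p@_u *: 'X_[u].

Lemma mcoeff_mfilter P p u : (mfilter P p)@_u = if P u then p@_u else 0.
Proof.
rewrite /mfilter raddf_sum big_mkcond /=.
have [up|nup] := boolP (u \in msupp p).
  rewrite (bigD1_seq u) ?msupp_uniq //= mcoeffZ mcoeffX eqxx mulr1.
  rewrite big1 ?addr0 // => v /negPf vu.
  by case: ifP => // _; rewrite mcoeffZ mcoeffX vu mulr0.
rewrite big1_seq ?(memN_msupp_eq0 nup) ?if_same // => v /= vp.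
case: ifP => // _; rewrite mcoeffZ mcoeffX.
by case: eqP => [vu|]; rewrite ?mulr0 // -vu vp in nup *.
Qed.

Lemma sum_mfilter (T : finType) (phi : 'X_{1..n} -> option T) p :
    (forall u, u \in msupp p -> phi u != None) ->
  \sum_(t : T) mfilter (fun u => phi u == Some t) p = p.
Proof.
move=> phiP; apply/mpolyP => u; rewrite raddf_sum /=.
have [up|nup] := boolP (u \in msupp p); last first.
  by rewrite (memN_msupp_eq0 nup) big1 // => t _;
    rewrite mcoeff_mfilter (memN_msupp_eq0 nup) if_same.
case E: (phi u) (phiP _ up) => [t|//] _.
rewrite (bigD1 t) //= mcoeff_mfilter E eqxx big1 ?addr0 // => t' t't.
by rewrite mcoeff_mfilter E (inj_eq Some_inj) eq_sym (negPf t't).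
Qed.

(* Monomials that are not divisible by X^b are sent to junk, because
   subtraction of exponents is truncated. *)
Definition mdiv p b : S := \sum_(u <- msupp p) p@_u *: 'X_[u - b].

Lemma mdivK p b :
  (forall u, u \in msupp p -> (b <= u)%MM) -> mdiv p b * 'X_[b] = p.
Proof.
move=> bP; rewrite /mdiv mulr_suml [RHS]mpolyE big_seq [RHS]big_seq.
apply: eq_bigr => u up; rewrite -scalerAl -mpolyXD submK //; exact: bP.
Qed.

Lemma mem_msupp_mfilter P p u :
  (u \in msupp (mfilter P p)) = P u && (u \in msupp p).
Proof. by rewrite !mcoeff_msupp mcoeff_mfilter; case: (P u); rewrite ?eqxx. Qed.

Lemma mem_msuppMX p b u : u \in msupp (p * 'X_[b]) -> (b <= u)%MM.
Proof.
by rewrite mcoeff_msupp mcoeffMX_if; case: ifP => //; rewrite eqxx.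
Qed.

Lemma mpolyX_neq0 b : 'X_[b] != 0 :> S.
Proof. by rewrite -msupp_eq0 msuppX. Qed.

(** For the converse, each monomial of [p] is assigned to one chosen generator dividing it, which
    splits [p] into multiples of single generators. The guard [P t] fits families padded with zeros,
    as in [irreducible_ideal]. *)
Lemma monomial_idealP (T : finType) (P : pred T) (f : T -> 'X_{1..n}) p :
  (exists c : T -> S, p = \sum_t c t * (if P t then 'X_[f t] else 0)) <->
  (forall u, u \in msupp p -> exists t, P t && (f t <= u)%MM).
Proof.
split=> [[c ->] u|Pp].
  move/msupp_sum_le/flattenP => [s /mapP[t _ ->]].
  by case: ifP => Pt; [move/mem_msuppMX => ftu; exists t; rewrite Pt |
                       rewrite mulr0 msupp0].
pose phi u := [pick t | P t && (f t <= u)%MM].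
exists (fun t => if P t then
          mdiv (mfilter (fun u => phi u == Some t) p) (f t) else 0).
rewrite -[LHS](@sum_mfilter _ phi); last first.
  move=> u /Pp [t Pt]; rewrite /phi; case: pickP => // /(_ t).
  by rewrite Pt.
apply: eq_bigr => t _; case: ifPn => Pt.
  rewrite mdivK // => u; rewrite mem_msupp_mfilter /phi => /andP[+ _].
  by case: pickP => // t' /andP[_ ?] /eqP[<-].
rewrite mul0r; apply/mpolyP => u; rewrite mcoeff_mfilter mcoeff0 /phi.
case: pickP => // t' /andP[Pt' _]; case: eqP => // -[tt'].
by rewrite -tt' Pt' in Pt.
Qed.

End MonomialOperations.

(** * Regularity bounds from the shifts of a resolution *)

(** Excluded middle decides whether a larger value occurs; the distance to [B] drops each time. *)
Lemma int_bounded_max (P : int -> Prop) (z0 B : int) :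
  P z0 -> (forall z, P z -> z <= B) ->
  exists r, P r /\ forall z, P z -> z <= r.
Proof.
move=> Pz0 PB.
have [m] := ubnP `|B - z0|%N; elim: m z0 Pz0 => // m IHm z0 Pz0 lt_m.
have [[z [Pz lt_z]]|max_z0] := classic (exists z, P z /\ z0 < z).
  by apply: (IHm z Pz); have := PB _ Pz; lia.
exists z0; split=> // z Pz; rewrite leNgt; apply/negP => lt_z.
by apply: max_z0; exists z.
Qed.

Section ResolutionShifts.
Variables (k : fieldType) (n : nat).
Local Notation S := {mpoly k[n]}.

Let order_ge (d : nat) (p : S) : Prop :=
  forall m, m \in msupp p -> (d <= mdeg m)%N.

Let order_geM d e (p q : S) :
  order_ge d p -> order_ge e q -> order_ge (d + e) (p * q).
Proof.
move=> dp eq m /msuppM_le/allpairsP[[m1 m2] /= [m1p m2q ->]].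
by rewrite mdegD leq_add ?dp ?eq.
Qed.

Let order_ge_sum d (J : eqType) (r : seq J) (F : J -> S) :
  (forall i, order_ge d (F i)) -> order_ge d (\sum_(i <- r) F i).
Proof.
move=> dF m /msupp_sum_le/flattenP[s /mapP[i _ ->]]; exact: dF.
Qed.

Variables (I : S -> Prop) (F : free_sequence k n).
Hypothesis resF : graded_free_resolution I F.

(** An entry with nonzero constant term has degree 0, so its source and target shifts agree. *)
Lemma deg_part_diff_k i j :
  deg_part F i.+1 j *m diff_k F i = diff_k F i *m deg_part F i j.
Proof.
apply/matrixP => e f; rewrite mul_diag_mx mul_mx_diag !mxE.
have [->|nz] := eqVneq (diff F i e f)@_0 0; first by rewrite mulr0 mul0r.
have := diff_homog resF (e := e) (f := f) (m := 0%MM).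
rewrite mcoeff_msupp nz => /(_ isT).
rewrite mdeg0 => /esym/eqP; rewrite subr_eq0 => /eqP ->.
by rewrite mulrC.
Qed.

(* Graded Nakayama: otherwise I = (x_1, ..., x_n) I. *)
Lemma tor_dim0_neq0 :
  (exists p, I p /\ p != 0) -> exists j, tor_dim F 0 j <> 0%N.
Proof.
case=> p0 [Ip0 p0_neq0]; apply: NNPP => no_tor.
have tor0 j : tor_dim F 0 j = 0%N.
  by apply: NNPP => nz; apply: no_tor; exists j.
(* The degree [j] image lies in the degree [j] part, and vanishing Tor makes the ranks equal. *)
have deg_sub j : (deg_part F 0 j <= diff_k F 0)%MS.
  apply: (submx_trans _ (submxMl (deg_part F 1 j) _)).
  have sub : (deg_part F 1 j *m diff_k F 0 <= deg_part F 0 j)%MS.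
    by rewrite deg_part_diff_k submxMl.
  rewrite -(geq_leqif (mxrank_leqif_sup sub)).
  by move/eqP: (tor0 j); rewrite /tor_dim /= subn_eq0 capmx1.
have /submxP[W W1] : (1%:M <= diff_k F 0)%MS.
  apply/row_subP => e; apply: submx_trans (deg_sub (shift e)).
  suff -> : row e 1%:M = row e (deg_part F 0 (shift e)) by apply: row_sub.
  by apply/rowP => f; rewrite !mxE eqxx.
(* [W] is a left inverse of the constant terms of [diff F 0], so [N] has entries in the maximal
   ideal, while [N *m aug F = aug F]. *)
pose N : 'M[S]_(frank F 0) := 1%:M - map_mx (@mpolyC n k) W *m diff F 0.
have N_ord e f : order_ge 1 (N e f).
  move=> m; rewrite lt0n mdeg_eq0; apply: contraTneq => ->.
  rewrite mcoeff_msupp negbK.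
  have : map_mx (mcoeff 0%MM) N = 0.
    have CK : map_mx (mcoeff 0%MM) (map_mx (@mpolyC n k) W) = W.
      by apply/matrixP => x y; rewrite !mxE mpolyCK.
    by rewrite map_mxB map_mx1 map_mxM /= CK -/(diff_k F 0) -W1 subrr.
  by move/matrixP/(_ e f); rewrite !mxE => ->.
have D0 : diff F 0 *m aug F = 0.
  apply/row_matrixP => e; rewrite row_mul row0; apply/(exact_at0 resF).
  by exists (delta_mx 0 e); rewrite -rowE.
have augE : aug F = N *m aug F.
  by rewrite mulmxBl mul1mx -mulmxA D0 mulmx0 subr0.
have Iaug f : I (aug F f 0).
  by apply/(aug_image resF); exists (delta_mx 0 f); rewrite -rowE mxE.
(* Iterating [augE] puts [I] in every power of the maximal ideal, so only 0 survives. *)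
have I_ord d : forall p, I p -> order_ge d p.
  elim: d => [//|d IHd] p /(aug_image resF)[v ->].
  rewrite augE mxE; apply: order_ge_sum => e.
  rewrite -[d.+1]add0n; apply: order_geM => //.
  rewrite mxE; apply: order_ge_sum => f.
  rewrite -add1n; apply: order_geM; [exact: N_ord | exact/IHd/Iaug].
move: p0_neq0; rewrite -msupp_eq0; case E: (msupp p0) => [//|m s] _.
have := @I_ord (mdeg m).+1 _ Ip0 m.
by rewrite E mem_head ltnn => /(_ isT).
Qed.

Lemma tor_dim_shift i j :
  tor_dim F i j <> 0%N -> exists e : 'I_(frank F i), shift e = j.
Proof.
move=> tor; apply: NNPP => noe; apply: tor; rewrite /tor_dim.
suff -> : deg_part F i j = 0 by rewrite cap0mx mxrank0.
apply/matrixP => e f; rewrite !mxE.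
by case: eqP => [se|_]; rewrite ?mul0rn //; case: noe; exists e.
Qed.

(** Shifts of any resolution, minimal or not, bound the degrees where Tor lives; a nonzero Tor in
    homological degree 0 ensures that the maximum exists. *)
Lemma regularity_le (B : int) :
  (exists p, I p /\ p != 0) ->
  (forall i (e : 'I_(frank F i)), shift e <= B + i%:Z) ->
  exists r, regularity I r /\ r <= B.
Proof.
move=> /tor_dim0_neq0[j0 nz0] shiftB.
pose P r := exists i j, tor_dim F i j <> 0%N /\ j - i%:Z = r.
have PB z : P z -> z <= B.
  by case=> i [j [/tor_dim_shift[e <-] <-]]; rewrite lerBlDr.
have P0 : P (j0 - 0%:Z) by exists 0%N, j0.
have [r [Pr r_max]] := int_bounded_max P0 PB.
exists r; split; last exact: PB.
exists (tor_dim F); split=> //; first by exists F.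
by move=> i j nz; apply: r_max; exists i, j.
Qed.

End ResolutionShifts.
(** * The Taylor resolution *)

Lemma big_tuple_cons (V : nmodType) (T : finType) (i : nat)
    (f : seq T -> V) :
  \sum_(s : i.+1.-tuple T) f s = \sum_(g : T) \sum_(s : i.-tuple T) f (g :: s).
Proof.
rewrite pair_bigA /=.
rewrite (reindex (fun p : T * i.-tuple T => [tuple of p.1 :: p.2])) //.
exists (fun s : i.+1.-tuple T => (thead s, [tuple of behead s])) =>
  [[g s]|s] _ /=.
  by congr pair; apply/val_inj.
by rewrite -tuple_eta.
Qed.

(** * The simplicial boundary on sequences with repetitions *)

Section BoundaryCoefficients.
Variables (R : comNzRingType) (T : finType).

(* For [size s = (size t).+1], the coefficient of t in the alternating sum
   of the sequences obtained from s by deleting one entry. *)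
Fixpoint boundary_coef (s t : seq T) : R :=
  if s is g :: s' then
    (s' == t)%:R -
      (if t is h :: t' then (h == g)%:R * boundary_coef s' t' else 0)
  else 0.

Lemma boundary_coef_sub s t : boundary_coef s t != 0 -> {subset t <= s}.
Proof.
elim: s t => [|g s IHs] t /=; first by rewrite eqxx.
have [<- _ x xs|_] := eqVneq s t; first by rewrite inE xs orbT.
case: t => [|h t]; first by rewrite subrr eqxx.
case: (h =P g) => [->|_]; last by rewrite mul0r subrr eqxx.
rewrite mul1r sub0r oppr_eq0 => /IHs st x; rewrite !inE.
by case/orP => [->//|/st ->]; rewrite orbT.
Qed.

Lemma sum_tuple_delta (V : lmodType R) i (s : seq T) (f : seq T -> V) :
  size s = i ->
  \sum_(t : i.-tuple T) (s == t)%:R *: f t = f s.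
Proof.
move=> /eqP si; rewrite (bigD1 (Tuple si)) //= eqxx scale1r big1 ?addr0 // => t.
by rewrite eq_sym -val_eqE /= => /negPf ->; rewrite scale0r.
Qed.

(** Writing D for the boundary, D(g :: s) = s - g :: Ds, so DD(g :: s) = Ds - Ds + g :: DDs, and
    induction kills the last term. *)
Lemma boundary_coef_comp i (s r : seq T) : size s = i.+2 -> size r = i ->
  \sum_(t : i.+1.-tuple T) boundary_coef s t * boundary_coef t r = 0.
Proof.
elim: i s r => [|i IHi] [//|g s] r /= [sz_s] sz_r;
  under eq_bigr do rewrite mulrBl;
  rewrite sumrB (@sum_tuple_delta R^o _ s (boundary_coef^~ r)) //;
  rewrite (big_tuple_cons _ (fun t => (if t is h :: t' then
    (h == g)%:R * boundary_coef s t' else 0) * boundary_coef t r)).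
- rewrite (bigD1 g) //= [X in _ - (_ + X)]big1 ?addr0; last first.
    by move=> h /negPf hg; rewrite big1 // => t _; rewrite hg !mul0r.
  case: r sz_r => // _.
  under eq_bigr do rewrite eqxx mul1r subr0 mulrC.
  have := @sum_tuple_delta R^o 0 [::] (boundary_coef s) erefl.
  under eq_bigr do rewrite eq_sym.
  by move=> ->; rewrite subrr.
rewrite (bigD1 g) //= [X in _ - (_ + X)]big1 ?addr0; last first.
  by move=> h /negPf hg; rewrite big1 // => t _; rewrite hg !mul0r.
case: r sz_r => // h r [sz_r].
under eq_bigr do rewrite eqxx mul1r mulrBr mulrCA.
rewrite sumrB -mulr_sumr IHi // mulr0 subr0.
under eq_bigr do rewrite mulrC eq_sym.
rewrite (@sum_tuple_delta R^o _ (h :: r) (boundary_coef s)) /= ?sz_r //.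
by rewrite subrr.
Qed.

End BoundaryCoefficients.

(** * The Taylor sequence and its exactness *)

Section TaylorResolution.
Variables (k : fieldType) (n : nat) (T : finType) (G : T -> 'X_{1..n}).
Local Notation S := {mpoly k[n]}.
Local Notation bd := (@boundary_coef k T).
Local Notation tup i e := (@enum_val _ (mem {:i.-tuple T}) e).

Definition mnm_lcm (s : seq T) : 'X_{1..n} :=
  [multinom (\max_(g <- s) G g j)%N | j < n].

Lemma mnm_lcm_leP s u :
  reflect (forall g, g \in s -> (G g <= u)%MM) (mnm_lcm s <= u)%MM.
Proof.
apply: (iffP mnm_lepP) => [le_su g gs | le_su j].
  apply/mnm_lepP => j; apply: leq_trans (le_su j).
  by rewrite mnmE (big_rem g) //= leq_maxl.
rewrite mnmE; apply/bigmax_leqP_seq => g gs _; exact/mnm_lepP/le_su.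
Qed.

Lemma mnm_lcm_sub s t : {subset t <= s} -> (mnm_lcm t <= mnm_lcm s)%MM.
Proof.
move=> st; apply/mnm_lcm_leP => g /st; move: g; apply/mnm_lcm_leP.
exact: lepm_refl.
Qed.

(** Truncated subtraction is exact whenever [bd s t] is nonzero, since the entries of [t] then lie
    in [s]. *)
Definition taylor_coef (s t : seq T) : S :=
  bd s t *: 'X_[mnm_lcm s - mnm_lcm t].

(* After multiplying the basis element of s by X^(lcm s), the Taylor
   differential becomes the scalar boundary map. *)
Lemma taylor_coefX s t :
  taylor_coef s t * 'X_[mnm_lcm t] = bd s t *: 'X_[mnm_lcm s].
Proof.
rewrite -scalerAl -mpolyXD.
have [->|/boundary_coef_sub st] := eqVneq (bd s t) 0; first by rewrite !scale0r.
by rewrite submK // mnm_lcm_sub.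
Qed.

Definition taylor_mx (i : nat) :
    'M[S]_(#|{:i.+1.-tuple T}|, #|{:i.-tuple T}|) :=
  \matrix_(e, f) taylor_coef (tup i.+1 e) (tup i f).

(** Homological degree [i] carries the tuples of length [i.+1], hence the index shift in
    [taylor_mx i.+1]; the augmentation is the differential to the empty tuple. *)
Definition taylor_sequence : free_sequence k n :=
  @FreeSequence k n (fun i => #|{:i.+1.-tuple T}|)
    (fun i e => (mdeg (mnm_lcm (tup i.+1 e)))%:Z)
    (\col_e taylor_coef (tup 1 e) [::])
    (fun i => taylor_mx i.+1).

Definition chain_of i (v : 'rV[S]_#|{:i.-tuple T}|) (s : i.-tuple T) : S :=
  v 0 (enum_rank s) * 'X_[mnm_lcm s].

Lemma sum_taylor i (v : 'rV[S]_#|{:i.+1.-tuple T}|) t :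
  (\sum_e v 0 e * taylor_coef (tup i.+1 e) t) * 'X_[mnm_lcm t] =
  \sum_(s : i.+1.-tuple T) bd s t *: chain_of v s.
Proof.
rewrite (big_enum_val (fun s : i.+1.-tuple T => bd s t *: chain_of v s)) /=.
rewrite mulr_suml; apply: eq_bigr => e _.
by rewrite -mulrA taylor_coefX /chain_of enum_valK scalerAr.
Qed.

Lemma taylor_aug0 (v : 'rV[S]_#|{:1.-tuple T}|) :
  v *m aug taylor_sequence = 0 <->
  forall t : 0.-tuple T, \sum_(s : 1.-tuple T) bd s t *: chain_of v s = 0.
Proof.
split=> [/matrixP/(_ 0 0) | bd0].
  rewrite !mxE => v0 t; rewrite (tuple0 t) -sum_taylor.
  apply/eqP; rewrite mulf_eq0; apply/orP; left; apply/eqP; rewrite -[RHS]v0.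
  by apply: eq_bigr => e _; rewrite mxE.
apply/matrixP => x y; rewrite !ord1 !mxE.
apply/(mulIf (mpolyX_neq0 k (mnm_lcm [::]))); rewrite mul0r.
rewrite -[RHS](bd0 [tuple]) -sum_taylor; congr (_ * _).
by apply: eq_bigr => e _; rewrite mxE.
Qed.

Lemma taylor_mx0 i (v : 'rV[S]_#|{:i.+1.-tuple T}|) :
  v *m taylor_mx i = 0 <->
  forall t : i.-tuple T, \sum_(s : i.+1.-tuple T) bd s t *: chain_of v s = 0.
Proof.
split=> [v0 t | bd0].
  move/matrixP/(_ 0 (enum_rank t)): v0; rewrite !mxE => v0.
  rewrite -sum_taylor.
  apply/eqP; rewrite mulf_eq0; apply/orP; left; apply/eqP; rewrite -[RHS]v0.
  by apply: eq_bigr => e _; rewrite mxE enum_rankK.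
apply/matrixP => x f; rewrite !ord1 !mxE.
apply/(mulIf (mpolyX_neq0 k (mnm_lcm (tup i f)))); rewrite mul0r.
rewrite -[RHS](bd0 (tup i f)) -sum_taylor; congr (_ * _).
by apply: eq_bigr => e _; rewrite mxE.
Qed.

Lemma chain_of_mulmx i (w : 'rV[S]_#|{:i.+1.-tuple T}|) (t : i.-tuple T) :
  chain_of (w *m taylor_mx i) t =
  \sum_(s : i.+1.-tuple T) bd s t *: chain_of w s.
Proof.
rewrite /chain_of mxE -sum_taylor; congr (_ * _).
by apply: eq_bigr => e _; rewrite mxE enum_rankK.
Qed.

Lemma taylor_boundary i (w : 'rV[S]_#|{:i.+2.-tuple T}|) (t : i.-tuple T) :
  \sum_(s : i.+1.-tuple T) bd s t *: chain_of (w *m taylor_mx i.+1) s = 0.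
Proof.
under eq_bigr do rewrite chain_of_mulmx scaler_sumr.
rewrite exchange_big big1 //= => r _.
under eq_bigr do rewrite scalerA mulrC.
by rewrite -scaler_suml boundary_coef_comp ?size_tuple ?scale0r.
Qed.

(** The cone vertex in multidegree [u], one fixed choice shared by all chains. *)
Definition first_divisor (u : 'X_{1..n}) : option T := [pick g | (G g <= u)%MM].

Let part g : S -> S := mfilter (fun u => first_divisor u == Some g).

Let part_bd g t i (x : i.-tuple T -> S) :
  \sum_(s : i.-tuple T) bd s t *: part g (x s) = 
  part g (\sum_(s : i.-tuple T) bd s t *: x s).
Proof.
apply/mpolyP => u; rewrite mcoeff_mfilter !raddf_sum /=.
case: ifP => gu; last first.
  by rewrite big1 // => s _; rewrite mcoeffZ mcoeff_mfilter gu mulr0.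
by apply: eq_bigr => s _; rewrite !mcoeffZ mcoeff_mfilter gu.
Qed.

(* In each multidegree u the Taylor complex is the chain complex of a full
   simplex, on the generators dividing X^u; coning from one of these vertices
   is a contraction. *)
Lemma taylor_exact i (v : 'rV[S]_#|{:i.+1.-tuple T}|) :
  (forall t : i.-tuple T,
    \sum_(s : i.+1.-tuple T) bd s t *: chain_of v s = 0) ->
  exists w : 'rV[S]_#|{:i.+2.-tuple T}|, v = w *m taylor_mx i.+1.
Proof.
move=> cycle_v.
pose vh (s : seq T) : S :=
  if insub s is Some s' then @chain_of i.+1 v s' else 0.
have vhE (s : i.+1.-tuple T) : vh s = chain_of v s by rewrite /vh valK.
(* The coefficient of [g :: s'] collects the multidegrees of [vh s'] whose cone vertex is [g]. *)
pose cone (s : seq T) : S := if s is g :: s' then part g (vh s') else 0.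
pose w := \row_e mdiv (cone (tup i.+2 e)) (mnm_lcm (tup i.+2 e)).
have wE (s : i.+2.-tuple T) : chain_of w s = cone s.
  rewrite /chain_of mxE enum_rankK mdivK //.
  case: s => -[//|g s] /= sz_s u; rewrite /part mem_msupp_mfilter.
  case/andP => gu; rewrite (vhE (Tuple (sz_s : size s == i.+1))).
  move/mem_msuppMX => su.
  apply/mnm_lcm_leP => h; rewrite inE => /orP[/eqP -> | hs].
    by move: gu; rewrite /first_divisor; case: pickP => // g' ? /eqP[<-].
  by move: h hs; apply/mnm_lcm_leP.
exists w; apply/rowP => e.
apply/(mulIf (mpolyX_neq0 k (mnm_lcm (tup i.+1 e)))).
have chainE (x : 'rV[S]_#|{:i.+1.-tuple T}|) :
    x 0 e * 'X_[mnm_lcm (tup i.+1 e)] = chain_of x (tup i.+1 e).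
  by rewrite /chain_of enum_valK.
rewrite !chainE {chainE}; move: (tup i.+1 e) => t {e}; rewrite chain_of_mulmx.
under [RHS]eq_bigr do rewrite wE.
rewrite (big_tuple_cons _ (fun s => bd s t *: cone s)) /=.
case: t => -[//|h t] /= sz_t.
(* [h] divides every monomial of [vh (h :: t)], so each has a cone vertex and the parts add up to
   the whole. *)
transitivity (\sum_g part g (vh (h :: t))).
  rewrite (vhE (Tuple (sz_t : size (h :: t) == i.+1))) sum_mfilter // => u.
  move/mem_msuppMX/mnm_lcm_leP/(_ h (mem_head _ _)) => hu.
  by rewrite /first_divisor; case: pickP => // /(_ h); rewrite hu.
apply: eq_bigr => g _.
under eq_bigr do rewrite scalerBl -scalerA.
rewrite sumrB -scaler_sumr.
under [X in _ - _ *: X]eq_bigr do rewrite vhE.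
(* Only the first term of D(g :: s) = s - g :: Ds survives: the second is the boundary of a
   cycle. *)
rewrite part_bd (cycle_v (Tuple (sz_t : size t == i))).
have -> : part g 0 = 0.
  by apply/mpolyP => u; rewrite mcoeff_mfilter mcoeff0 if_same.
rewrite scaler0 subr0.
under eq_bigr do rewrite eq_sym.
by rewrite (sum_tuple_delta (fun s => part g (vh s))) //; apply/eqP.
Qed.

Lemma zhomog_taylor_coef s t :
  zhomog ((mdeg (mnm_lcm s))%:Z - (mdeg (mnm_lcm t))%:Z) (taylor_coef s t).
Proof.
move=> m; rewrite /taylor_coef.
have [->|nz] := eqVneq (bd s t) 0; first by rewrite scale0r msupp0.
have st := mnm_lcm_sub (boundary_coef_sub nz).
rewrite msuppMCX // inE => /eqP ->.
by rewrite -{2}(submK st) mdegD PoszD addrK.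
Qed.

Lemma taylor_resolution (I : S -> Prop) :
  (forall p, I p <-> forall u, u \in msupp p -> exists g, (G g <= u)%MM) ->
  graded_free_resolution I taylor_sequence.
Proof.
move=> IP; have lcm0 : mnm_lcm [::] = 0%MM.
  by apply/mnmP => j; rewrite !mnmE big_nil.
split=> /=.
- move=> e; rewrite mxE; have := @zhomog_taylor_coef (tup 1 e) [::].
  by rewrite lcm0 mdeg0 subr0.
- by move=> i e f; rewrite mxE; apply: zhomog_taylor_coef.
- move=> p; rewrite IP.
  have augE (v : 'rV[S]_#|{:1.-tuple T}|) :
      (v *m aug taylor_sequence) 0 0 =
      \sum_(s : 1.-tuple T) v 0 (enum_rank s) *
        (if predT s then 'X_[mnm_lcm s] else 0).
    rewrite mxE (big_enum_val (fun s : 1.-tuple T =>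
      v 0 (enum_rank s) * (if predT s then 'X_[mnm_lcm s] else 0))) /=.
    apply: eq_bigr => e _; rewrite mxE enum_valK /taylor_coef lcm0 subm0.
    by case: (enum_val e) => -[|g [|]] //= sz; rewrite subr0 scale1r.
  transitivity (forall u, u \in msupp p ->
      exists s : 1.-tuple T, predT s && (mnm_lcm s <= u)%MM).
    split=> Ip u /Ip [].
      move=> g gu; exists [tuple g]; apply/mnm_lcm_leP => h.
      by rewrite inE => /eqP ->.
    by move=> s /mnm_lcm_leP su; exists (thead s); apply/su/mem_tnth.
  rewrite -monomial_idealP; split=> [[c pE] | [v ->]].
    exists (\row_e c (enum_val e)); rewrite augE pE.
    by apply: eq_bigr => s _; rewrite mxE enum_rankK.
  by exists (fun s => v 0 (enum_rank s)); rewrite augE.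
- by move=> v; rewrite taylor_aug0; split=> [/taylor_exact // | [w ->] t];
    apply: taylor_boundary.
move=> i v; rewrite taylor_mx0; split=> [/taylor_exact // | [w ->] t].
exact: taylor_boundary.
Qed.

End TaylorResolution.
(** * Generators of the special dual *)

Lemma card_ord_geq s i : #|[set x : 'I_s | (i <= x)%N]| = (s - i)%N.
Proof.
rewrite -sum1_card; under eq_bigl do rewrite inE.
by rewrite -(big_geq_mkord _ _ predT (fun=> 1%N)) sum_nat_const_nat muln1.
Qed.

Section SpecialDual.
Variables (n : nat) (H : ui_hypergraph n).
Local Notation s := (nedges H).
Local Notation a := (containment_vector H).

(** Edges are nested, so those containing x_j form a final segment of the indices, of length
    [a j]. *)
Lemma mem_edge (i : 'I_s) (j : 'I_n) : (j \in edge i) = (s - i <= a j)%N.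
Proof.
rewrite mnmE; apply/idP/idP => [ji | ].
  rewrite -card_ord_geq subset_leq_card //; apply/subsetP => x; rewrite !inE.
  rewrite leq_eqVlt => /orP[/eqP/val_inj <- // | ix].
  exact: (subsetP (edge_sub ix)).
apply: contraLR => nji; rewrite -ltnNge.
apply: (@leq_ltn_trans (s - i.+1)); last by rewrite subnS prednK ?subn_gt0.
rewrite -card_ord_geq subset_leq_card //; apply/subsetP => x; rewrite !inE.
apply: contraTT; rewrite -ltnNge ltnS leq_eqVlt.
case/orP => [/eqP/val_inj -> // | xi].
by apply: contra nji; apply/subsetP/edge_sub.
Qed.

(** By [mem_edge], the condition on [j] says that [i] lies in the interval from [s - a j] to
    [s - a j + u j], upper end excluded. *)
Definition in_dual (u : 'X_{1..n}) : bool :=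
  [forall i : 'I_s, exists j, (j \in edge i) && (a j + 1 - (s - i) <= u j)%N].

Lemma special_dualP (k : fieldType) (p : {mpoly k[n]}) :
  special_dual H p <-> (forall u, u \in msupp p -> in_dual u).
Proof.
have dualE (i : 'I_s) (j : 'I_n) : mnm_setminus a (inclusion_exponent i) j =
    if j \in edge i then (a j + 1 - (s - i))%N else 0%N.
  rewrite mnmE [inclusion_exponent i j]mnmE; case: (j \in edge i) => //.
  by rewrite subn_gt0 ltn_ord.
have mem (i : 'I_s) :
    irreducible_ideal (mnm_setminus a (inclusion_exponent i)) p <->
    forall u, u \in msupp p ->
    exists j, (j \in edge i) && (a j + 1 - (s - i) <= u j)%N.
  set v := mnm_setminus a _.
  have -> : (forall u, u \in msupp p ->
      exists j, (j \in edge i) && (a j + 1 - (s - i) <= u j)%N) <->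
      (forall u, u \in msupp p ->
      exists j, (1 <= v j)%N && (U_(j) *+ v j <= u)%MM).
    have E (j : 'I_n) u : (1 <= v j)%N && (U_(j) *+ v j <= u)%MM =
        (j \in edge i) && (a j + 1 - (s - i) <= u j)%N.
      have -> : (U_(j) *+ v j <= u)%MM = (v j <= u j)%N.
        apply/mnm_lepP/idP => [/(_ j)|vu l];
          rewrite mulmnE mnm1E ?eqxx ?mul1n //.
        by case: eqP => [<-|]; rewrite ?mul1n.
      have -> : v j = _ := dualE i j; case: ifP => // ji.
      by rewrite addn1 subn_gt0 ltnS -mem_edge ji.
    by split=> hp u /hp[j hj]; exists j; move: hj; rewrite E.
  rewrite -(monomial_idealP (fun j => 1 <= v j)%N (fun j => U_(j) *+ v j)%MM).
  by split=> -[c ->]; exists c; apply: eq_bigr => j _; rewrite mpolyXn.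
split=> [Ip u up | Ip i].
  apply/forallP => i; apply/existsP; exact: ((mem i).1 (Ip i) u up).
by apply/mem => u /Ip/forallP/(_ i)/existsP.
Qed.

Definition full_vertices (u : 'X_{1..n}) : {set 'I_n} :=
  [set j | (0 < a j)%N && (a j <= u j)%N].

(** A finite generating set that may exceed the minimal one; the last two conditions feed the degree
    count. *)
Definition is_dual_generator (u : 'X_{1..n}) : bool :=
  [&& in_dual u, (u <= a)%MM & (#|full_vertices u| <= 1)%N].

Definition dual_generator : finType :=
  {u : 'X_{1..n < (mdeg a).+1} | is_dual_generator u}.

Definition generator_mnm (g : dual_generator) : 'X_{1..n} := val (val g).

(* If x and y both have full exponent and a_y <= a_x, the interval of x
   contains that of y, so y can be lowered. *)
Lemma in_dual_decr (u : 'X_{1..n}) y :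
  (a y < u y)%N \/ (exists x, [&& x != y, a y <= a x & a x <= u x]%N) ->
  in_dual u -> in_dual (u - U_(y)).
Proof.
move=> decr /forallP du; apply/forallP => i; apply/existsP.
have [j /andP[ji ju]] := existsP (du i).
have lt_i := ltn_ord i.
have ge_ji := ji; rewrite mem_edge in ge_ji.
have [jy|jy] := eqVneq j y; last first.
  by exists j; rewrite ji mnmBE mnm1E eq_sym (negPf jy) subn0.
subst j; case: decr => [ay | [x /and3P[xy yx xu]]].
  by exists y; rewrite ji mnmBE mnm1E eqxx; lia.
exists x; rewrite mem_edge (leq_trans ge_ji yx) mnmBE mnm1E eq_sym.
by rewrite (negPf xy); lia.
Qed.

(** Descent on the degree: a monomial failing the test can be lowered by one in some variable
    without leaving the dual. *)
Lemma dual_generator_exists u :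
  in_dual u -> exists g, (generator_mnm g <= u)%MM.
Proof.
have [m] := ubnP (mdeg u); elim: m u => // m IHm u lt_m du.
have [gen_u|] := boolP (is_dual_generator u).
  have lt_a : (mdeg u < (mdeg a).+1)%N.
    case/and3P: gen_u => _ /mnm_lepP ua _.
    by rewrite ltnS !mdegE; apply: leq_sum => j _; apply: ua.
  by exists (exist _ (BMultinom lt_a) gen_u); apply: lepm_refl.
have decr y : (0 < u y)%N ->
    (a y < u y)%N \/ (exists x, [&& x != y, a y <= a x & a x <= u x]%N) ->
    exists g, (generator_mnm g <= u)%MM.
  move=> uy dy; have [||g gu] := IHm (u - U_(y))%MM.
  - have Uu : (U_(y) <= u)%MM by rewrite lep1mP -lt0n.
    by move: lt_m; rewrite -{1}(submK Uu) mdegD mdeg1; lia.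
  - exact: in_dual_decr.
  by exists g; apply: lepm_trans gu (lem_subr _ _).
rewrite /is_dual_generator du /= negb_and => /orP[|].
  rewrite negb_forall => /existsP[y]; rewrite -ltnNge => ay.
  by apply: (decr y); [lia | left].
rewrite -ltnNge => /card_gt1P[x [y [+ + xy]]].
rewrite !inE => /andP[x0 xu] /andP[y0 yu].
have [yx|/ltnW yx] := leqP (a y) (a x).
  by apply: (decr y); [lia | right; exists x; rewrite xy yx].
by apply: (decr x); [lia | right; exists y; rewrite eq_sym xy yx].
Qed.

Lemma in_dual_le u v : (u <= v)%MM -> in_dual u -> in_dual v.
Proof.
move=> /mnm_lepP uv /forallP du; apply/forallP => i.
have [j /andP[ji ju]] := existsP (du i); apply/existsP; exists j.
by rewrite ji (leq_trans ju).
Qed.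

Lemma in_dual_containment : in_dual a.
Proof.
apply/forallP => i; apply/existsP.
have /card_gt0P[j ji] : (0 < #|edge i|)%N.
  exact: leq_trans (edge_card_ge2 i).
by exists j; rewrite ji; have := ltn_ord i; lia.
Qed.

(** A maximum reaches [a j > 0] only if some generator does, and each generator has at most one full
    vertex. *)
Lemma card_full_lcm (t : seq dual_generator) :
  (#|full_vertices (mnm_lcm generator_mnm t)| <= size t)%N.
Proof.
elim: t => [|g t IHt].
  rewrite leqn0 cards_eq0; apply/eqP/setP => j.
  by rewrite !inE [mnm_lcm _ _ j]mnmE big_nil; case: (a j).
have /and3P[_ _ g1] := valP g.
apply: leq_trans (leq_add g1 IHt : (_ <= (size t).+1)%N).
apply: leq_trans (leq_card_setU _ _).
apply/subset_leq_card/subsetP => j; rewrite !inE ![mnm_lcm _ _ j]mnmE big_cons.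
by rewrite leq_max => /andP[-> /=].
Qed.

(** Coordinatewise: where [a j > 0], the lcm stays at least one below [a j] unless [j] is full. *)
Lemma mdeg_lcm_le (t : seq dual_generator) :
  (mdeg (mnm_lcm generator_mnm t) + #|[set j | 0 < a j]| <= mdeg a + size t)%N.
Proof.
apply: (@leq_trans (mdeg a + #|full_vertices (mnm_lcm generator_mnm t)|));
  last by rewrite leq_add2l card_full_lcm.
have /mnm_lepP le_a : (mnm_lcm generator_mnm t <= a)%MM.
  by apply/mnm_lcm_leP => g _; case/and3P: (valP g).
have cardE (P : pred 'I_n) : #|[set j | P j]| = (\sum_j P j)%N.
  by rewrite -sum1dep_card big_mkcond; apply: eq_bigr => j _; case: (P j).
rewrite /full_vertices !cardE !mdegE -!big_split /=.
by apply: leq_sum => j _; have := le_a j; lia.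
Qed.

Lemma card_edge_ge (i : 'I_s) : (i.+2 <= #|edge i|)%N.
Proof.
case: i => i; elim: i => [|i IHi] lt_i; first exact: edge_card_ge2.
have := IHi (ltnW lt_i).
have -> := edge_card_step (i := Ordinal (ltnW lt_i)) (j := Ordinal lt_i) erefl.
by have := step_gt0 H => /=; lia.
Qed.

(** The largest edge has at least s + 1 vertices, and each has a positive [a j]. *)
Lemma card_containment_gt0 : (s < #|[set j | 0 < a j]|)%N.
Proof.
have s0 := nedges_gt0 H; have lt_s : (s.-1 < s)%N by rewrite prednK.
have := card_edge_ge (Ordinal lt_s); rewrite /= prednK // => /leq_trans-> //.
apply/subset_leq_card/subsetP => j; rewrite inE mem_edge /=; lia.
Qed.

End SpecialDual.

(* In the sum, the vertex x_(j+1) has index j : 'I_n, so 0 < j is i >= 2. *)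
Theorem corollary3p6 (k : fieldType) (hk : infinite_field k) (n : nat)
    (H : ui_hypergraph n) :
  exists r : int, regularity (@special_dual k n H) r /\
    r <= (\sum_(j < n | (0 < j)%N) containment_vector H j)%N%:Z.
Proof.
have resF : graded_free_resolution (@special_dual k n H)
    (taylor_sequence k (@generator_mnm n H)).
  apply: taylor_resolution => p; rewrite special_dualP.
  split=> Ip u /Ip; first exact: dual_generator_exists.
  by case=> g /in_dual_le; apply; case/and3P: (valP g).
apply: (regularity_le resF).
  exists 'X_[containment_vector H]; split; last exact: mpolyX_neq0.
  by apply/special_dualP => u /mem_msuppXP <-; apply: in_dual_containment.
move=> i e /=; rewrite -PoszD lez_nat.
have := mdeg_lcm_le (enum_val e); rewrite size_tuple.
have := card_containment_gt0 H.
case: n H {resF} e => [|n] H e.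
  by move=> /leq_trans/(_ (max_card _)); rewrite card_ord.
move: (mdeg (mnm_lcm _ _)) => m {e}.
(* With N vertices of positive [a j], a_1 <= s < N turns the bound |a| - N + i + 1 into |a| - a_1 +
   i. *)
have a0 : (containment_vector H ord0 <= nedges H)%N.
  by rewrite mnmE -[X in (_ <= X)%N]card_ord max_card.
rewrite [mdeg (containment_vector H)]mdegE (bigD1 ord0) //=.
rewrite (eq_bigl (fun j : 'I_n.+1 => 0 < j)%N); last by move=> j; rewrite lt0n.
lia.
Qed.
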